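(* Let $\pi_n^\rho(\cdot\mid F_n)$ be an M-posterior whose loss $\rho$ is bounded from below and whose score $\psi$ is bounded on $\mathcal X\times\Theta$. Let $\pi$ be a bounded (possibly improper) prior density on $\Theta$, and assume one of: (a) $\int_\Theta|\theta|\pi(\theta)d\theta<\infty$ and $\sup_{\theta\in\Theta}\pi(\theta)|\theta|<\infty$; or (b) for each $x$, $\theta\mapsto\rho(x,\theta)$ is convex and coercive, i.e. $\rho(x,\theta)\to\infty$ as $|\theta|\to\infty$. Then $\pi_n^\rho(\cdot\mid F_n)$ is uniformly B-robust.
   Context: Sample space $\mathcal X\subseteq\mathbb R^d$, parameter space $\Theta\subseteq\mathbb R$ an interval containing $0$, loss $\rho:\mathcal X\times\Theta\to\mathbb R$ differentiable in $\theta$ with score $\psi(x,\theta)=\partial_\theta\rho(x,\theta)$, prior density $\pi\ge0$ on $\Theta$ (possibly improper). For a distribution $G$ on $\mathcal X$, the M-posterior is $\pi_n^\rho(\theta\mid G)=\pi(\theta)\exp(-n\mathbb E_G[\rho(X,\theta)])/\int_\Theta\pi(\theta')\exp(-n\mathbb E_G[\rho(X,\theta')])d\theta'$ whenever the denominator is finite and positive. $F_n$ is the empirical distribution of a fixed sample $x_1,\dots,x_n\in\mathcal X$. For $x_0\in\mathcal X$, $\epsilon\in[0,1]$, $F_{n,\epsilon,x_0}=(1-\epsilon)F_n+\epsilon\delta_{x_0}$. Posterior influence function: $\mathrm{PIF}(x_0;\theta,\rho,F_n)=\frac{d}{d\epsilon}\pi_n^\rho(\theta\mid F_{n,\epsilon,x_0})\big|_{\epsilon=0}$.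 The M-posterior is uniformly B-robust if $\sup_{\theta\in\Theta}\sup_{x_0\in\mathcal X}|\mathrm{PIF}(x_0;\theta,\rho,F_n)|<\infty$. *)

(* Defs.v *)
From HB Require Import structures.
From mathcomp Require Import all_boot all_order all_algebra.
From mathcomp Require Import all_classical all_reals all_analysis.
Set Implicit Arguments. Unset Strict Implicit. Unset Printing Implicit Defensive.
Import Order.TTheory GRing.Theory Num.Theory.
Import numFieldNormedType.Exports.
Local Open Scope classical_set_scope.
Local Open Scope ring_scope.

Section MPosterior.
Variables (R : realType) (d : nat).

Definition deriv_within (S : set R) (f : R -> R) (t l : R) : Prop :=
  (fun h : R => h^-1 * (f (t + h) - f t)) @ within [set h | S (t + h)] 0^' --> l.

Definition emp_risk (n : nat) (x : 'I_n -> 'rV[R]_d)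
  (rho : 'rV[R]_d -> R -> R) (t : R) : R :=
  n%:R^-1 * \sum_(i < n) rho (x i) t.

(* E_{F_{n,eps,x0}}[rho(X, t)], F_{n,eps,x0} = (1-eps) F_n + eps delta_{x0} *)
Definition cont_risk (n : nat) (x : 'I_n -> 'rV[R]_d)
  (rho : 'rV[R]_d -> R -> R) (eps : R) (x0 : 'rV[R]_d) (t : R) : R :=
  (1 - eps) * emp_risk x rho t + eps * rho x0 t.

(* normalising constant  int_Theta pi(t) exp(-n E_G[rho(X,t)]) dt,
   for the expected-loss function L t = E_G[rho(X,t)] *)
Definition Mnorm (Theta : set R) (pi : R -> R) (n : nat) (L : R -> R) : \bar R :=
  (\int[lebesgue_measure]_(t in Theta) (pi t * expR (- (n%:R * L t)))%:E)%E.

(* M-posterior density at t (meaningful when 0 < Mnorm < +oo) *)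
Definition Mpost (Theta : set R) (pi : R -> R) (n : nat) (L : R -> R) (t : R) : R :=
  pi t * expR (- (n%:R * L t)) / fine (Mnorm Theta pi n L).

Definition cont_post_defined (Theta : set R) (pi : R -> R) (n : nat)
  (x : 'I_n -> 'rV[R]_d) (rho : 'rV[R]_d -> R -> R) (eps : R) (x0 : 'rV[R]_d) : Prop :=
  (0 < Mnorm Theta pi n (cont_risk x rho eps x0) < +oo)%E.

Definition is_PIF (Theta : set R) (pi : R -> R) (n : nat)
  (x : 'I_n -> 'rV[R]_d) (rho : 'rV[R]_d -> R -> R) (x0 : 'rV[R]_d) (t l : R) : Prop :=
  (fun eps : R => eps^-1 *
     (Mpost Theta pi n (cont_risk x rho eps x0) t
      - Mpost Theta pi n (cont_risk x rho 0 x0) t)) @ 0^'+ --> l.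

Definition uniformly_B_robust (X : set 'rV[R]_d) (Theta : set R) (pi : R -> R)
  (n : nat) (x : 'I_n -> 'rV[R]_d) (rho : 'rV[R]_d -> R -> R) : Prop :=
  exists C : R, forall (t : R) (x0 : 'rV[R]_d), Theta t -> X x0 ->
    (forall eps : R, 0 <= eps <= 1 -> cont_post_defined Theta pi x rho eps x0) /\
    exists l : R, is_PIF Theta pi x rho x0 t l /\ `|l| <= C.

End MPosterior.

(* Main.v *)
Require Import Defs.
From HB Require Import structures.
From mathcomp Require Import all_boot all_order all_algebra.
From mathcomp Require Import all_classical all_reals all_analysis.
From mathcomp Require Import measurable_realfun ring lra.
Import Order.TTheory GRing.Theory Num.Theory.
Import numFieldNormedType.Exports.
Local Open Scope classical_set_scope.
Local Open Scope ring_scope.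

(** Put [g = pi exp(-n L)] with [L] the empirical risk, [Z = int g], and
    [W = -n (rho(x0, .) - L)], so that the contaminated weight is [g exp(eps W)].
    Differentiating the quotient at [eps = 0] gives
    [PIF = g(t) (W(t) Z - int g W) / Z^2 = g(t) int g(s) (W(t) - W(s)) ds / Z^2].
    Only differences of [W] occur, and since the score is bounded by [M], [W] is
    [2nM]-Lipschitz uniformly in [x0]; as [|t - s| <= (1 + |t|) (1 + |s|)], it
    suffices that [(1 + |t|) g(t)] is bounded and integrable.  This follows from
    the moment conditions on [pi] in case (a); in case (b) a convex coercive loss
    grows at least linearly, so that [g] decays exponentially. *)

Set Implicit Arguments.
Unset Strict Implicit.
Unset Printing Implicit Defensive.

(** * Derivatives relative to an interval *)

(** Near [t] the difference quotient is at most [|l| + 1] in absolute value, which gives a Lipschitz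
    estimate at [t]. *)
Lemma deriv_within_cvg (R : realType) (S : set R) (f : R -> R) (t l : R) :
  S t -> deriv_within S f t l -> f @ within S (nbhs t) --> f t.
Proof.
move=> St /cvgrPdist_lt fl; apply/cvgrPdist_lt => e e0.
have [r /= r0 rP] := fl 1 ltr01.
have K0 : 0 < `|l| + 1 by rewrite ltr_pwDr.
exists (Num.min r (e / (`|l| + 1))) => /=; first by rewrite lt_min r0 divr_gt0.
move=> y /=; rewrite lt_min => /andP[yr ye] Sy.
have [->|yt] := eqVneq y t; first by rewrite subrr normr0.
have yt0 : y - t != 0 by rewrite subr_eq0.
have tyE : t + (y - t) = y by rewrite addrC subrK.
have := rP (y - t); rewrite /= sub0r normrN distrC => /(_ yr yt0).
rewrite tyE => /(_ Sy) q1.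
have q2 : `|(y - t)^-1 * (f y - f t)| <= `|l| + 1.
  by rewrite -[X in `|X|](subrK l) (le_trans (ler_normD _ _))// addrC lerD2l distrC ltW.
rewrite distrC -(mulVKf yt0 (f y - f t)) normrM.
rewrite (le_lt_trans (ler_wpM2l _ q2))// -ltr_pdivlMr//.
by rewrite distrC.
Qed.

Lemma deriv_within_continuous (R : realType) (S : set R) (f df : R -> R) :
  (forall t, S t -> deriv_within S f t (df t)) -> {within S, continuous f}.
Proof.
move=> fdf; apply/subspace_continuousP => t St.
exact: deriv_within_cvg (fdf _ St).
Qed.

(** At an interior point every small [h] keeps [t + h] in [S], so the restriction on [h] disappears.
    This supplies the ordinary derivatives required by the mean value theorem. *)
Lemma deriv_within_is_derive (R : realType) (S : set R) (f : R -> R) (t l : R) :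
  S° t -> deriv_within S f t l -> is_derive t 1 f l.
Proof.
move=> St fl.
have fl' : (fun h : R => h^-1 *: (f (h *: 1 + t) - f t)) @ 0^' --> l.
  apply/cvgrPdist_lt => e e0; move/cvgrPdist_lt : fl => /(_ e e0)[r /= r0 rP].
  have [s /= s0 sP] := St.
  exists (Num.min r s) => /=; first by rewrite lt_min r0.
  move=> h /=; rewrite lt_min => /andP[hr hs] h0.
  rewrite /GRing.scale /= mulr1 [h + t]addrC; apply: rP => //=.
  by apply: sP; rewrite /= opprD addrA subrr.
split; first by apply/cvg_ex; exists l.
exact/cvg_lim.
Qed.

(** Mean value theorem on [[s, t]]: the endpoints may be boundary points of [i], but only continuity
    is required there. *)
Lemma deriv_within_lipschitz (R : realType) (i : interval R) (f df : R -> R)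
    (M : R) :
  (forall t, t \in i -> deriv_within [set` i] f t (df t)) ->
  (forall t, t \in i -> `|df t| <= M) ->
  forall s t, s \in i -> t \in i -> `|f s - f t| <= M * `|s - t|.
Proof.
move=> fdf dfM.
suff H s t : s < t -> s \in i -> t \in i -> `|f t - f s| <= M * `|t - s|.
  move=> s t si ti; have [st|ts|->] := ltgtP s t; last by rewrite !subrr normr0 mulr0.
    by rewrite distrC (distrC s) H.
  exact: H.
move=> st si ti.
have sub : `[s, t] `<=` [set` i].
  by move=> u; apply: (@interval_is_interval _ i).
have cf : {within `[s, t], continuous f}.
  exact: continuous_subspaceW sub (@deriv_within_continuous _ _ _ df _).
have df' u : u \in `]s, t[ -> is_derive u 1 f (df u).
  move=> ust; apply: (@deriv_within_is_derive _ [set` i]).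
    suff H : `]s, t[%classic `<=` [set` i]° by exact: H ust.
    rewrite -open_subsetE; last exact: interval_open.
    by move=> v /subset_itv_oo_cc; exact: sub.
  by apply: fdf; apply: sub; exact: subset_itv_oo_cc.
have [c cst ->] := MVT st df' cf.
rewrite normrM ler_wpM2r// dfM//.
exact/sub/subset_itv_oo_cc.
Qed.

(** * Tangent and chord inequalities for the exponential *)

Lemma expR_tangent_le (R : realType) (u v : R) :
  expR u * (1 + (v - u)) <= expR v.
Proof.
by rewrite -[in leRHS](subrKC u v) expRD ler_pM2l ?expR_gt0// expR_ge1Dx.
Qed.

Lemma expR_chord_ge (R : realType) (u v e : R) : 0 < e ->
  expR u * (v - u) <= e^-1 * (expR ((1 - e) * u + e * v) - expR u).
Proof.
move=> e0; rewrite ler_pdivlMl//.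
rewrite lerBrDr; apply: (le_trans _ (expR_tangent_le u _)).
by rewrite le_eqVlt; apply/orP; left; apply/eqP; ring.
Qed.

Lemma expR_conv_le (R : realType) (u v e : R) : 0 <= e <= 1 ->
  expR ((1 - e) * u + e * v) <= (1 - e) * expR u + e * expR v.
Proof.
move=> /andP[e0 e1]; set m := _ + _; have tangent w := expR_tangent_le m w.
(* The tangent at the mean [m] is averaged: the deviations [u - m] and [v - m] cancel under the
   weights [1 - e] and [e]. *)
have -> : expR m = (1 - e) * (expR m * (1 + (u - m))) + e * (expR m * (1 + (v - m))).
  by rewrite /m; ring.
by rewrite lerD// ler_wpM2l// subr_ge0.
Qed.

Lemma expR_chord_le (R : realType) (u v e : R) : 0 < e <= 1 ->
  e^-1 * (expR ((1 - e) * u + e * v) - expR u) <= expR v - expR u.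
Proof.
move=> /andP[e0 e1]; rewrite ler_pdivrMl// lerBlDr.
rewrite (le_trans (expR_conv_le _ _ _))// ?(ltW e0)//.
by rewrite le_eqVlt; apply/orP; left; apply/eqP; ring.
Qed.

(* The chord slope is squeezed between the tangent slopes at its two endpoints. *)
Lemma cvg_expR_chord (R : realType) (u v : R) :
  e^-1 * (expR ((1 - e) * u + e * v) - expR u) @[e --> 0^'+] --> expR u * (v - u).
Proof.
pose m (e : R) := (1 - e) * u + e * v.
have m_cvg : m e @[e --> 0^'+] --> u.
  rewrite [X in _ --> X](_ : u = m 0); last by rewrite /m; ring.
  apply: cvg_at_right_filter; rewrite /m.
  by apply: cvgD; apply: cvgMr_tmp => //; apply: cvgB => //; exact: cvg_cst.
apply: (@squeeze_cvgr _ _ _ _ (cst (expR u * (v - u)))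
    (fun e => expR (m e) * (v - u))).
- near=> e; have e0 : 0 < e by [].
  rewrite expR_chord_ge//= ler_pdivrMl//.
  rewrite lerBlDr -lerBlDl.
  apply: (le_trans _ (expR_tangent_le (m e) u)).
  by rewrite le_eqVlt; apply/orP; left; apply/eqP; rewrite /m; ring.
- exact: cvg_cst.
- apply: cvgMr_tmp; apply: continuous_cvg => //; exact: continuous_expR.
Unshelve. all: by end_near. Qed.

(** * Differentiation under the integral along a tilted weight *)

Section tilt.
Variables (R : realType) (D : set R) (p U V : R -> R).
Hypothesis mD : measurable D.
Hypothesis p0 : forall t, D t -> 0 <= p t.
Hypotheses (mp : measurable_fun D p) (mU : measurable_fun D U)
  (mV : measurable_fun D V).
Let mu := @lebesgue_measure R.

(** Log-linear path from the weight [p exp U] at [e = 0] to [p exp V] at [e = 1]; [p] stays outside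
    the exponential because it may vanish. *)
Definition tilt (e t : R) : R := p t * expR ((1 - e) * U t + e * V t).

Lemma measurable_tilt e : measurable_fun D (tilt e).
Proof.
apply: measurable_funM => //; apply: measurableT_comp => //.
by apply: measurable_funD; apply: measurable_funM.
Qed.

Hypothesis iU : mu.-integrable D (EFin \o (fun t => p t * expR (U t))).
Hypothesis iV : mu.-integrable D (EFin \o (fun t => p t * expR (V t))).

(** By convexity of the exponential, the tilted weight lies below the arithmetic mixture of the two
    integrable end weights. *)
Lemma integrable_tilt e : 0 <= e <= 1 -> mu.-integrable D (EFin \o tilt e).
Proof.
move=> e01; have [e0 e1] := andP e01.
have i1 : mu.-integrable D (fun t =>
    (1 - e)%:E * (p t * expR (U t))%:E + e%:E * (p t * expR (V t))%:E)%E.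
  by apply: integrableD => //; exact: integrableZl.
apply: le_integrable i1 => //.
  by apply/measurable_EFinP; exact: measurable_tilt.
move=> t Dt /=; rewrite lee_fin.
have t0 : 0 <= tilt e t by rewrite mulr_ge0 ?expR_ge0 ?p0.
rewrite ger0_norm// ger0_norm; last first.
  by rewrite addr_ge0// !mulr_ge0 ?subr_ge0 ?expR_ge0 ?p0.
rewrite mulrCA (mulrCA e) -mulrDr ler_wpM2l ?p0//.
exact: expR_conv_le.
Qed.

Hypothesis iUV : mu.-integrable D (EFin \o (fun t => p t * expR (U t) * (V t - U t))).

(* Dominated convergence: by convexity of exp, for [0 < e <= 1] the difference
   quotient lies between its limit at [0] and its value at [e = 1]. *)
Lemma cvg_Rintegral_tilt :
  e^-1 * (Rintegral mu D (tilt e) - Rintegral mu D (tilt 0)) @[e --> 0^'+] -->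
  Rintegral mu D (fun t => p t * expR (U t) * (V t - U t)).
Proof.
have iq e : 0 < e <= 1 ->
    (e^-1 * (Rintegral mu D (tilt e) - Rintegral mu D (tilt 0)))%:E =
    (\int[mu]_(t in D) (e^-1 * (tilt e t - tilt 0 t))%:E)%E.
  move=> /andP[e0 e1].
  have ie : mu.-integrable D (EFin \o tilt e) by apply: integrable_tilt; rewrite (ltW e0).
  have i0 : mu.-integrable D (EFin \o tilt 0) by apply: integrable_tilt; rewrite lexx ler01.
  have iB : mu.-integrable D (EFin \o (fun t => tilt e t - tilt 0 t)).
    rewrite (_ : EFin \o _ = (EFin \o tilt e) \- (EFin \o tilt 0))%E//.
    exact: integrableB.
  rewrite -RintegralB// -RintegralZl//.
  rewrite /Rintegral fineK//; apply: integrable_fin_num => //.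
  under eq_fun do rewrite EFinM; exact: integrableZl.
apply/cvg_at_rightP => w [w0 wcvg].
(* The domination is available only for parameters at most [1], which a sequence tending to [0]
   satisfies from some rank [N] on; hence the shift. *)
have [N _ wN] : \forall k \near \oo, w k <= 1.
  by move/cvgr_le : wcvg; apply; exact: ltr01.
rewrite -(cvg_shiftn N).
have w01 k : 0 < w (k + N)%N <= 1 by rewrite w0 wN//= leq_addl.
pose q k t := (w (k + N)%N)^-1 * (tilt (w (k + N)%N) t - tilt 0 t).
rewrite [X in X @ _ --> _](_ : _ = fine \o (fun k => (\int[mu]_(t in D) (q k t)%:E)%E)); last first.
  by apply/funext => k /=; rewrite -iq.
apply: fine_cvg; rewrite /Rintegral fineK; last exact: integrable_fin_num.
have qE k t : q k t = p t *
    ((w (k + N)%N)^-1 * (expR ((1 - w (k + N)%N) * U t + w (k + N)%N * V t) - expR (U t))).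
  by rewrite /q /tilt subr0 mul1r mul0r addr0; ring.
(* The first two terms absorb the upper bound [expR V - expR U] on the chord slope, the last one the
   tangent slope bounding it below. *)
pose G (t : R) : R := p t * expR (U t) + p t * expR (V t) + `|p t * expR (U t) * (V t - U t)|.
have [] := @dominated_convergence _ _ _ mu D mD (fun k => EFin \o q k)
    (EFin \o (fun t => p t * expR (U t) * (V t - U t))) (EFin \o G).
- move=> k; apply/measurable_EFinP; apply: measurable_funM => //.
  by apply: measurable_funB; exact: measurable_tilt.
- exact: measurable_int iUV.
- apply: aeW => t Dt; apply: cvg_EFin; first exact: nearW.
  rewrite (_ : _ \o _ = q ^~ t)//; under eq_fun do rewrite qE.
  rewrite -mulrA; apply: cvgMl_tmp.
  have /cvg_at_rightP := @cvg_expR_chord R (U t) (V t).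
  move=> /(_ (fun k => w (k + N)%N)); apply; split; first by move=> k; exact: w0.
  by rewrite (cvg_shiftn N).
- rewrite (_ : EFin \o G = (EFin \o (fun t => p t * expR (U t))%R) \+
    (EFin \o (fun t => p t * expR (V t))%R) \+
    (abse \o (EFin \o (fun t => p t * expR (U t) * (V t - U t))%R)))%E//.
  apply: integrableD => //; [exact: integrableD | exact: integrable_abse iUV].
- apply: aeW => t k Dt; rewrite /= lee_fin qE normrM (ger0_norm (p0 Dt)).
  have [wk0 wk1] := andP (w01 k).
  have := expR_chord_ge (U t) (V t) wk0.
  have := expR_chord_le (U t) (V t) (w01 k).
  move: (_^-1 * _) => c cV cU; rewrite /G -mulrA normrM (ger0_norm (p0 Dt)) -!mulrDr.
  rewrite ler_wpM2l ?p0// ler_norml.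
  have := ler_norm (expR (U t) * (V t - U t)).
  have := ler_norm (- (expR (U t) * (V t - U t))); rewrite normrN.
  have := expR_ge0 (U t); have := expR_ge0 (V t).
  set a := expR _ * _ in cU *; move=> *; apply/andP; split; lra.
- by [].
Qed.

End tilt.

(** * Linear growth and exponential decay *)

(** Coercivity lifts [f] by at least [1] above [f 0] from radius [K] on. Convexity on the segment
    from [0] to [t], tested at its point of modulus [K], propagates this rise to
    [f t - f 0 >= |t| / K]. *)
Lemma convex_coercive_ge_linear (R : realType) (i : interval R) (f : R -> R) (c : R) :
  0 \in i ->
  (forall a b l : R, a \in i -> b \in i -> 0 <= l <= 1 ->
    f (l * a + (1 - l) * b) <= l * f a + (1 - l) * f b) ->
  (forall M : R, exists K : R, forall t, t \in i -> K <= `|t| -> M <= f t) ->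
  (forall t, t \in i -> c <= f t) ->
  exists a b : R, 0 < a /\ forall t, t \in i -> a * `|t| + b <= f t.
Proof.
move=> i0 cvx coer fc.
have [K0 HK0] := coer (f 0 + 1).
pose K := Num.max K0 1.
have K_gt0 : 0 < K by rewrite lt_max ltr01 orbT.
have HK t : t \in i -> K <= `|t| -> f 0 + 1 <= f t.
  by move=> ti Kt; apply: HK0 => //; rewrite (le_trans _ Kt)// le_max lexx.
(* Inside radius [K] the linear term is at most [1], so the intercept [c - 1] keeps the sum below
   the lower bound [c]. *)
exists K^-1, (c - 1); split; first by rewrite invr_gt0.
move=> t ti; have [tK|Kt] := ltP `|t| K.
  have : K^-1 * `|t| <= 1 by rewrite ler_pdivrMl// mulr1 ltW.
  by have := fc _ ti; lra.
have t_gt0 : 0 < `|t| by apply: lt_le_trans Kt.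
pose l := K / `|t|.
have l01 : 0 <= l <= 1 by rewrite divr_ge0 ?(ltW K_gt0)//= ler_pdivrMr// mul1r.
have /andP[l0 l1] := l01.
have sE : l * t = l * t + (1 - l) * 0 by rewrite mulr0 addr0.
have si : l * t \in i.
  have [t0|t0] := leP 0 t.
    apply: (@interval_is_interval _ i 0 t) => //.
    by rewrite mulr_ge0//= ler_piMl.
  apply: (@interval_is_interval _ i t 0) => //.
  by rewrite mulr_ge0_le0 ?(ltW t0)// andbT ler_niMl// ltW.
have ns : `|l * t| = K by rewrite normrM ger0_norm// divfK// gt_eqF.
have := HK _ si; rewrite ns lexx => /(_ isT) fs.
have := cvx t 0 l ti i0 l01; rewrite -sE => fs'.
have : 1 <= l * (f t - f 0) by lra.
rewrite /l mulrAC ler_pdivlMr// mul1r -ler_pdivrMl// => ft.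
by have := fc _ i0; lra.
Qed.

(** With [y = |t|], it is enough to bound [(1 + y) (1 + y^2) <= (1 + y)^4] by a multiple of
    [exp (a y)]. The choice of [k] gives [1 + y <= k exp (a y / 4)], whose fourth power is the
    required bound. *)
Lemma expR_decay (R : realType) (a : R) : 0 < a ->
  exists2 C : R, 0 <= C & forall t : R,
    (1 + `|t|) * expR (- (a * `|t|)) <= C * (1 + t ^+ 2)^-1.
Proof.
move=> a0; pose k := 1 + 4 / a.
have k0 : 0 < k by rewrite addr_gt0// divr_gt0.
exists (k ^+ 4); first by rewrite exprn_ge0// ltW.
move=> t; set y := `|t|; have y0 : 0 <= y by exact: normr_ge0.
have -> : t ^+ 2 = y ^+ 2 by rewrite /y real_normK// num_real.
have e1 : 1 + y <= k * expR (a * y / 4).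
  apply: (@le_trans _ _ (k * (1 + a * y / 4))); last first.
    by rewrite ler_wpM2l ?(ltW k0)// expR_ge1Dx.
  have -> : k * (1 + a * y / 4) = 1 + y + (4 / a + a * y / 4).
    by rewrite /k; field; rewrite gt_eqF.
  by rewrite lerDl addr_ge0// ?divr_ge0 ?mulr_ge0// ltW.
have e4 : (1 + y) ^+ 4 <= k ^+ 4 * expR (a * y).
  have -> : expR (a * y) = expR (a * y / 4) ^+ 4.
    by rewrite -expRM_natl; congr expR; field.
  by rewrite -exprMn; apply: lerXn2r => //; rewrite nnegrE ?addr_ge0// mulr_ge0 ?expR_ge0// ltW.
have y2 : 0 < 1 + y ^+ 2 by rewrite ltr_pwDl// sqr_ge0.
rewrite expRN ler_pdivlMr// mulrAC ler_pdivrMr ?expR_gt0//.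
apply: le_trans e4.
(* The gap [(1 + y)^4 - (1 + y) (1 + y^2)] equals [y (1 + y)^3 + 2 y (1 + y)]. *)
have : 0 <= y * (1 + y) ^+ 3 by rewrite mulr_ge0// exprn_ge0// addr_ge0.
have : 0 <= y * (1 + y) by rewrite mulr_ge0// addr_ge0.
nra.
Qed.

Lemma integrable_oneDsqrV (R : realType) :
  (@lebesgue_measure R).-integrable setT (EFin \o (fun t : R => (1 + t ^+ 2)^-1)).
Proof.
have cont := @continuous_oneDsqrV R.
apply/integrableP; split.
  by apply/measurable_EFinP; exact: continuous_measurable_fun.
have d0 (t : R) : 0 <= (1 + t ^+ 2)^-1 by rewrite invr_ge0 addr_ge0// sqr_ge0.
under eq_integral do rewrite /= ger0_norm//.
rewrite (@ge0_symfun_integralT _ (fun t : R => (1 + t ^+ 2)^-1))//; last first.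
  by move=> t /=; rewrite sqrrN.
rewrite -set_itvcy; have := @integral0y_oneDsqr R; rewrite /oneDsqr => ->.
by rewrite -EFinM ltry.
Qed.

(** * Positivity, quotients and weighted integral bounds *)

(** If the integral of [g] were zero, [g] and hence [f] would vanish almost everywhere. This
    transfers positivity between weights differing only by exponential factors. *)
Lemma integral_gt0_supp (R : realType) (D : set R) (f g : R -> R) :
  measurable D -> measurable_fun D f -> measurable_fun D g ->
  (forall t, D t -> 0 <= f t) -> (forall t, D t -> 0 <= g t) ->
  (forall t, D t -> g t = 0 -> f t = 0) ->
  (0 < \int[lebesgue_measure]_(t in D) (f t)%:E)%E ->
  (0 < \int[lebesgue_measure]_(t in D) (g t)%:E)%E.
Proof.
move=> mD mf mg f0 g0 gf If; rewrite lt_neqAle integral_ge0 ?andbT; last first.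
  by move=> t Dt; rewrite lee_fin g0.
apply/eqP => Ig; move: If; rewrite lt_neqAle => /andP[/eqP + _]; apply.
have absE h : (forall t, D t -> 0 <= h t) ->
    (\int[lebesgue_measure]_(t in D) `|(h t)%:E| = \int[lebesgue_measure]_(t in D) (h t)%:E)%E.
  by move=> h0; apply: eq_integral => t /set_mem Dt; rewrite gee0_abs// lee_fin h0.
have mEf : measurable_fun D (EFin \o f) by exact/measurable_EFinP.
have mEg : measurable_fun D (EFin \o g) by exact/measurable_EFinP.
rewrite -absE//; apply/esym/(ae_eq_integral_abs lebesgue_measure mD mEf).
have /(ae_eq_integral_abs lebesgue_measure mD mEg)[N [mN N0 sN]] :
  (\int[lebesgue_measure]_(t in D) `|(g t)%:E| = 0)%E by rewrite absE.
exists N; split => // t /= ft; apply: sN => /= gt0; apply: ft => Dt.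
by have [/gf ->] := gt0 Dt.
Qed.

Lemma cvg_diff_quotient (R : realType) (N Z : R -> R) (N' Z' : R) :
  Z 0 != 0 ->
  e^-1 * (N e - N 0) @[e --> 0^'+] --> N' ->
  e^-1 * (Z e - Z 0) @[e --> 0^'+] --> Z' ->
  e^-1 * (N e / Z e - N 0 / Z 0) @[e --> 0^'+] -->
    (N' * Z 0 - N 0 * Z') / Z 0 ^+ 2.
Proof.
move=> Z0 cN cZ.
have cvgZ : Z e @[e --> 0^'+] --> Z 0.
  (* Right continuity of [Z] at [0] is read off its difference quotient, since [e] times a
     convergent quotient tends to [0]. *)
  have H : e * (e^-1 * (Z e - Z 0)) + Z 0 @[e --> 0^'+] --> 0 * Z' + Z 0.
    apply: cvgD; last exact: cvg_cst.
    by apply: cvgM => //; apply: cvg_at_right_filter; exact: cvg_id.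
  rewrite mul0r add0r in H; apply: cvg_trans H; apply: near_eq_cvg.
  near=> e; have e0 : e != 0 by rewrite gt_eqF.
  by rewrite mulVKf// subrK.
have nZ : \forall e \near 0^'+, Z e != 0.
  exact: (cvgr_neq0 (Z 0)).
have H : (e^-1 * (N e - N 0) * Z 0 - N 0 * (e^-1 * (Z e - Z 0))) / (Z e * Z 0)
    @[e --> 0^'+] --> (N' * Z 0 - N 0 * Z') / (Z 0 * Z 0).
  apply: cvgM.
    by apply: cvgB; [exact: cvgMr_tmp | exact: cvgMl_tmp].
  by apply: cvgV; [rewrite mulf_neq0 | exact: cvgMr_tmp].
rewrite expr2; apply: cvg_trans H; apply: near_eq_cvg.
near=> e; have e0 : e != 0 by rewrite gt_eqF.
have Ze : Z e != 0 by near: e.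
by field; rewrite e0 Ze Z0.
Unshelve. all: by end_near. Qed.

(* Both cases are dominated through [1 / (1 + t^2)]; in the first one this uses
   [p t <= 2 B / (1 + t^2) + |t| p t], the first term taking care of [|t| < 1]. *)
Lemma weighted_density_tail (R : realType) (D : set R) (p U : R -> R) (B c : R) :
  measurable D -> measurable_fun D p -> measurable_fun D U ->
  (forall t, D t -> 0 <= p t <= B) -> (forall t, D t -> U t <= c) ->
  ((\int[lebesgue_measure]_(t in D) (`|t| * p t)%:E < +oo)%E /\
     (exists C : R, forall t, D t -> p t * `|t| <= C)) \/
  (exists a b : R, 0 < a /\ forall t, D t -> a * `|t| + b <= - U t) ->
  (@lebesgue_measure R).-integrable D
    (EFin \o (fun t => (1 + `|t|) * (p t * expR (U t)))) /\
  exists A : R, forall t, D t -> (1 + `|t|) * (p t * expR (U t)) <= A.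
Proof.
move=> mD mp mU pB Uc H.
set F := fun t => _.
have F0 t : D t -> 0 <= F t.
  move=> Dt; have /andP[p0 _] := pB _ Dt.
  by rewrite /F mulr_ge0 ?addr_ge0// mulr_ge0// expR_ge0.
have mF : measurable_fun D (EFin \o F).
  apply/measurable_EFinP; apply: measurable_funM.
    by apply: measurable_funD => //; exact: measurable_funTS.
  by apply: measurable_funM => //; exact: measurableT_comp.
have iq : (@lebesgue_measure R).-integrable D (EFin \o (fun t : R => (1 + t ^+ 2)^-1)).
  exact: integrableS (@integrable_oneDsqrV R).
have q0 (t : R) : 0 < (1 + t ^+ 2)^-1 by rewrite invr_gt0 ltr_pwDl// sqr_ge0.
have q1 (t : R) : (1 + t ^+ 2)^-1 <= 1 by rewrite invf_le1 ?ltr_pwDl ?sqr_ge0// lerDl sqr_ge0.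
case: H => [[ip [C pC]]|[a [b [a0 Uab]]]].
  have ip' : (@lebesgue_measure R).-integrable D (EFin \o (fun t => `|t| * p t)).
    apply/integrableP; split.
      by apply/measurable_EFinP; apply: measurable_funM => //; exact: measurable_funTS.
    rewrite (_ : integral _ _ _ = \int[lebesgue_measure]_(t in D) (`|t| * p t)%:E)%E//.
    apply: eq_integral => t /set_mem Dt /=; have /andP[p0 _] := pB _ Dt.
    by rewrite ger0_norm// mulr_ge0.
  have FE t : D t -> F t <= expR c * ((1 + `|t|) * p t).
    move=> Dt; have /andP[p0 _] := pB _ Dt.
    rewrite /F mulrA [leRHS]mulrC ler_wpM2l ?ler_expR ?Uc//.
    by rewrite mulr_ge0// addr_ge0.
  split; last first.
    exists (expR c * (B + C)) => t Dt; apply: (le_trans (FE _ Dt)).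
    rewrite ler_wpM2l ?expR_ge0// mulrDl mul1r [`|t| * _]mulrC lerD ?pC//.
    by have /andP[] := pB _ Dt.
  (* The factor [2] before [|t| p t] counts one copy from expanding [(1 + |t|) p t] and one from the
     bound on [p t] itself. *)
  have iG : (@lebesgue_measure R).-integrable D (fun t =>
    (expR c)%:E * ((2 * B)%:E * ((1 + t ^+ 2)^-1)%:E + 2%:E * (`|t| * p t)%:E))%E.
    by apply: integrableZl => //; apply: integrableD => //; exact: integrableZl.
  apply: le_integrable iG => // t Dt; rewrite lee_fin.
  have /andP[p0 pb] := pB _ Dt.
  have tp0 : 0 <= `|t| * p t by rewrite mulr_ge0.
  have B0 : 0 <= B by exact: le_trans pb.
  have r0 : 0 <= 2 * B * (1 + t ^+ 2)^-1 by rewrite !mulr_ge0// ltW.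
  rewrite (ger0_norm (F0 _ Dt)); apply: (le_trans _ (ler_norm _)).
  apply: (le_trans (FE _ Dt)); rewrite ler_wpM2l ?expR_ge0// mulrDl mul1r.
  suff : p t <= 2 * B * (1 + t ^+ 2)^-1 + `|t| * p t by lra.
  have [t1|t1] := leP 1 `|t|.
    have : p t <= `|t| * p t by rewrite ler_peMl.
    lra.
  apply: (@le_trans _ _ (2 * B * (1 + t ^+ 2)^-1)); last by lra.
  rewrite ler_pdivlMr ?ltr_pwDl ?sqr_ge0//.
  have t2 : t ^+ 2 <= 1.
    by rewrite -real_normK ?num_real// expr_le1// ltW.
  nra.
have [K K0 HK] := expR_decay a0.
(* A point of [D] is needed to deduce [0 <= B]. *)
have [D0|/set0P[t0 Dt0]] := eqVneq D set0.
  rewrite D0; split; first exact: integrable_set0.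
  by exists 0.
have B0 : 0 <= B by have /andP[p0] := pB _ Dt0; exact: le_trans.
pose k := B * expR (- b) * K.
have k0 : 0 <= k by rewrite !mulr_ge0 ?expR_ge0.
have FE t : D t -> F t <= k * (1 + t ^+ 2)^-1.
  move=> Dt; have /andP[p0 pb] := pB _ Dt.
  rewrite /F /k -mulrA.
  apply: (@le_trans _ _ (B * expR (- b) * ((1 + `|t|) * expR (- (a * `|t|))))).
    have -> : B * expR (- b) * ((1 + `|t|) * expR (- (a * `|t|))) =
      (1 + `|t|) * (B * (expR (- b) * expR (- (a * `|t|)))) by ring.
    rewrite ler_wpM2l ?addr_ge0// ler_pM ?expR_ge0// -expRD ler_expR.
    by have := Uab _ Dt; lra.
  by rewrite ler_wpM2l ?HK// mulr_ge0 ?expR_ge0.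
split; last first.
  exists k => t Dt; apply: (le_trans (FE _ Dt)).
  by rewrite ler_piMr.
have iG : (@lebesgue_measure R).-integrable D (fun t => k%:E * ((1 + t ^+ 2)^-1)%:E)%E.
  exact: integrableZl.
apply: le_integrable iG => // t Dt; rewrite lee_fin.
rewrite (ger0_norm (F0 _ Dt)); apply: (le_trans _ (ler_norm _)).
exact: FE.
Qed.

Lemma le_integrable_EFin (R : realType) (D : set R) (f g : R -> R) :
  measurable D -> measurable_fun D f -> (forall t, D t -> `|f t| <= g t) ->
  (@lebesgue_measure R).-integrable D (EFin \o g) ->
  (@lebesgue_measure R).-integrable D (EFin \o f).
Proof.
move=> mD mf fg ig; apply: le_integrable ig => //; first exact/measurable_EFinP.
by move=> t Dt; rewrite lee_fin (le_trans (fg _ Dt))// ler_norm.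
Qed.

Lemma integrable_EFinZl (R : realType) (D : set R) (f : R -> R) (k : R) :
  measurable D ->
  (@lebesgue_measure R).-integrable D (EFin \o f) ->
  (@lebesgue_measure R).-integrable D (EFin \o (fun t => k * f t)).
Proof.
move=> mD jf; rewrite (_ : EFin \o _ = (fun t => k%:E * (EFin \o f) t)%E)//.
exact: integrableZl.
Qed.

(** Moving [W t] under the integral leaves only differences of [W]. The bound separates [t] from
    [s], so that the factor [1 + |t|] can later be absorbed by [g t]. *)
Lemma weighted_deviation_le (R : realType) (D : set R) (g W : R -> R) (K t : R) :
  measurable D -> measurable_fun D g -> measurable_fun D W ->
  (forall s, D s -> 0 <= g s) -> 0 <= K ->
  (forall s, D s -> `|W t - W s| <= K * `|t - s|) ->
  (@lebesgue_measure R).-integrable D (EFin \o g) ->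
  (@lebesgue_measure R).-integrable D (EFin \o (fun s => g s * W s)) ->
  (@lebesgue_measure R).-integrable D (EFin \o (fun s => (1 + `|s|) * g s)) ->
  `|W t * Rintegral lebesgue_measure D g
    - Rintegral lebesgue_measure D (fun s => g s * W s)|
  <= K * (1 + `|t|) * Rintegral lebesgue_measure D (fun s => (1 + `|s|) * g s).
Proof.
move=> mD mg mW g0 K0 WK ig igW i1g.
have iWg : (@lebesgue_measure R).-integrable D (EFin \o (fun s => W t * g s)).
  exact: integrable_EFinZl.
have iK : (@lebesgue_measure R).-integrable D
    (EFin \o (fun s => K * (1 + `|t|) * ((1 + `|s|) * g s))).
  exact: integrable_EFinZl.
have idev : (@lebesgue_measure R).-integrable D
    (EFin \o (fun s => W t * g s - g s * W s)).
  rewrite (_ : EFin \o _ = (EFin \o (fun s => W t * g s)%R) \-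
    (EFin \o (fun s => g s * W s)%R))%E//.
  exact: integrableB.
rewrite -RintegralZl// -RintegralB// -RintegralZl//.
apply: le_trans; first exact: le_normr_Rintegral.
apply: le_Rintegral => //; first exact: integrable_abse idev.
move=> s Ds.
have -> : W t * g s - g s * W s = (W t - W s) * g s by ring.
rewrite normrM (ger0_norm (g0 _ Ds)) mulrA ler_wpM2r ?g0//.
rewrite (le_trans (WK _ Ds))// -mulrA ler_wpM2l// (le_trans (ler_normB _ _))//.
(* [(1 + |t|) (1 + |s|)] exceeds [|t| + |s|] by [1 + |t| |s|]. *)
have : 0 <= `|t| * `|s| by rewrite mulr_ge0.
by lra.
Qed.

Unset Implicit Arguments.
Set Strict Implicit.
Set Printing Implicit Defensive.

(** * Uniform B-robustness of the M-posterior *)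

Theorem mainTheorem6 (R : realType) (d : nat) (X : set 'rV[R]_d)
  (i : interval R) (rho psi : 'rV[R]_d -> R -> R) (pi : R -> R)
  (n : nat) (x : 'I_n -> 'rV[R]_d) :
  (* standing assumptions *)
  0 \in i ->
  (forall x1, X x1 -> forall t, t \in i -> deriv_within [set` i] (rho x1) t (psi x1 t)) ->
  (forall t, t \in i -> 0 <= pi t) ->
  measurable_fun [set` i] pi ->
  (0 < n)%N ->
  (forall k, X (x k)) ->
  (* the M-posterior pi_n^rho(. | F_n) is well defined *)
  (0 < Mnorm [set` i] pi n (emp_risk x rho) < +oo)%E ->
  (* rho bounded from below, psi bounded on X x Theta *)
  (exists c : R, forall x1 t, X x1 -> t \in i -> c <= rho x1 t) ->
  (exists M : R, forall x1 t, X x1 -> t \in i -> `|psi x1 t| <= M) ->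
  (* bounded prior *)
  (exists B : R, forall t, t \in i -> pi t <= B) ->
  (* (a) or (b) *)
  ( ((\int[lebesgue_measure]_(t in [set` i]) (`|t| * pi t)%:E < +oo)%E /\
     exists C : R, forall t, t \in i -> pi t * `|t| <= C)
    \/
    (forall x1, X x1 ->
       (forall a b (l : R), a \in i -> b \in i -> 0 <= l <= 1 ->
          rho x1 (l * a + (1 - l) * b) <= l * rho x1 a + (1 - l) * rho x1 b) /\
       (forall M : R, exists K : R, forall t, t \in i -> K <= `|t| -> M <= rho x1 t)) ) ->
  uniformly_B_robust X [set` i] pi x rho.
Proof.
move=> i0 drho p0 mp n0 Xx defd [c rc] [M psiM] [B pB] ab.
set D : set R := [set` i] in defd ab *.
have mD : measurable D by exact: measurable_itv.
pose nn : R := n%:R.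
have nn0 : 0 < nn by rewrite ltr0n.
pose k0 : 'I_n := Ordinal n0.
have M0 : 0 <= M by exact: le_trans (psiM _ _ (Xx k0) i0).
have mrho x1 : X x1 -> measurable_fun D (rho x1).
  move=> Xx1; apply: subspace_continuous_measurable_fun => //.
  exact: deriv_within_continuous (drho _ Xx1).
have lip x1 s t : X x1 -> s \in i -> t \in i -> `|rho x1 s - rho x1 t| <= M * `|s - t|.
  move=> Xx1; apply: deriv_within_lipschitz (drho _ Xx1) _ _ _ => u ui.
  exact: psiM.
have nnE t : nn * emp_risk x rho t = \sum_(k < n) rho (x k) t.
  by rewrite /emp_risk mulVKf// gt_eqF.
have lip0 s t : s \in i -> t \in i ->
    `|nn * emp_risk x rho s - nn * emp_risk x rho t| <= nn * M * `|s - t|.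
  move=> si ti; rewrite !nnE -sumrB (le_trans (ler_norm_sum _ _ _))//.
  apply: (@le_trans _ _ (\sum_(k < n) M * `|s - t|)).
    by apply: ler_sum => k _; exact: lip.
  by rewrite sumr_const card_ord -mulr_natl mulrA.
pose U t := - (nn * emp_risk x rho t).
have mU : measurable_fun D U.
  apply: measurable_funN; under eq_fun do rewrite nnE.
  by apply: measurable_sum => k; exact: mrho.
have p0B t : D t -> 0 <= pi t <= B by move=> Dt; rewrite p0 ?pB.
have tailU : (@lebesgue_measure R).-integrable D
      (EFin \o (fun t => (1 + `|t|) * (pi t * expR (U t)))) /\
    exists A : R, forall t, D t -> (1 + `|t|) * (pi t * expR (U t)) <= A.
  apply: (@weighted_density_tail _ _ _ _ B (- \sum_(k < n) c)) => //.
    by move=> t Dt; rewrite /U nnE lerN2; apply: ler_sum => k _; exact: rc.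
  case: ab => [ab|ab]; [by left|right].
  have [cvx coer] := ab _ (Xx k0).
  have [a [b [a0 lin]]] := convex_coercive_ge_linear i0 cvx coer (fun t => rc _ t (Xx k0)).
  (* Linear growth of the loss at the single observation [k0] suffices: the other losses are bounded
     below by [c]. *)
  exists a, (b + \sum_(k < n | k != k0) c); split=> // t Dt.
  rewrite /U opprK nnE [leRHS](bigD1 k0)//= addrA lerD ?lin//.
  by apply: ler_sum => k _; exact: rc.
have [iU [A UA]] := tailU.
(* This is the endpoint [e = 1], where all mass sits at [x0]; its integrability is needed for
   interpolation and domination. *)
have tailV x0 : X x0 -> (@lebesgue_measure R).-integrable D
    (EFin \o (fun t => (1 + `|t|) * (pi t * expR (- (nn * rho x0 t))))).
  move=> Xx0.
  apply: (@weighted_density_tail _ _ _ (fun t => - (nn * rho x0 t)) B (- (nn * c)) _ _ _ _ _ _).1 => //.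
  - by apply: measurable_funN; apply: measurable_funM => //; exact: mrho.
  - by move=> t Dt; rewrite lerN2 ler_wpM2l ?(ltW nn0)// rc.
  case: ab => [ab|ab]; [by left|right].
  have [cvx coer] := ab _ Xx0.
  have [a [b [a0 lin]]] := convex_coercive_ge_linear i0 cvx coer (fun t => rc _ t Xx0).
  exists (nn * a), (nn * b); split=> [|t Dt]; first by rewrite mulr_gt0.
  by rewrite opprK -mulrA -mulrDr ler_wpM2l ?(ltW nn0)// lin.
have drop1 (W : R -> R) : measurable_fun D W -> (@lebesgue_measure R).-integrable D
      (EFin \o (fun t => (1 + `|t|) * (pi t * expR (W t)))) ->
    (@lebesgue_measure R).-integrable D (EFin \o (fun t => pi t * expR (W t))).
  move=> mW; apply: le_integrable_EFin => //.
    by apply: measurable_funM => //; exact: measurableT_comp.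
  move=> t Dt; have w0 : 0 <= pi t * expR (W t) by rewrite mulr_ge0 ?expR_ge0 ?p0.
  by rewrite ger0_norm// ler_peMl// lerDl.
pose g t := pi t * expR (U t).
have g0 t : D t -> 0 <= g t by move=> Dt; rewrite mulr_ge0 ?expR_ge0 ?p0.
have mg : measurable_fun D g by apply: measurable_funM => //; exact: measurableT_comp.
have ig : (@lebesgue_measure R).-integrable D (EFin \o g) by exact: drop1.
pose Z := Rintegral lebesgue_measure D g.
pose I1 := Rintegral lebesgue_measure D (fun t => (1 + `|t|) * g t).
have Z0 : 0 < Z by rewrite /Z /Rintegral fine_gt0.
(* Fixed before [t] and [x0]: [2 n M] is the Lipschitz constant of [W], [A] bounds [(1 + |t|) g t],
   [I1] is the integral left by the deviation bound, and [Z^2] comes from the quotient rule. *)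
exists (2 * (nn * M) * A * I1 / Z ^+ 2) => t x0 Dt Xx0.
pose V s := - (nn * rho x0 s).
have mV : measurable_fun D V.
  by apply: measurable_funN; apply: measurable_funM => //; exact: mrho.
have iV := drop1 _ mV (tailV _ Xx0).
pose W s := V s - U s.
have mW : measurable_fun D W by exact: measurable_funB.
have lipW s u : D s -> D u -> `|W s - W u| <= 2 * (nn * M) * `|s - u|.
  move=> Ds Du.
  have -> : W s - W u = (nn * emp_risk x rho s - nn * emp_risk x rho u)
    - nn * (rho x0 s - rho x0 u) by rewrite /W /V /U; ring.
  rewrite (le_trans (ler_normB _ _))// [in leRHS](_ : 2 * (nn * M) * `|s - u| =
    nn * M * `|s - u| + nn * (M * `|s - u|)); last by ring.
  rewrite lerD ?lip0// normrM (gtr0_norm nn0) ler_wpM2l ?(ltW nn0)//.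
  exact: lip.
have igW : (@lebesgue_measure R).-integrable D (EFin \o (fun s => g s * W s)).
  (* Anchoring the Lipschitz bound at [0], which lies in [i], shows that [W] grows at most
     linearly. *)
  apply: (@le_integrable_EFin _ _ _ (fun s => (`|W 0| + 2 * (nn * M)) * ((1 + `|s|) * g s))) => //.
  - exact: measurable_funM.
  - move=> s Ds; rewrite normrM (ger0_norm (g0 _ Ds)) mulrC mulrA ler_wpM2r ?g0//.
    have := lipW _ _ Ds i0; rewrite subr0 => h.
    have h1 : `|W s| <= `|W 0| + 2 * (nn * M) * `|s|.
      by rewrite -[X in `|X|](subrK (W 0)) addrC (le_trans (ler_normD _ _))// lerD2l.
    apply: (le_trans h1).
    have h2 : 0 <= `|W 0| * `|s| by rewrite mulr_ge0.
    have h3 : 0 <= nn * M by rewrite mulr_ge0// ltW.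
    by lra.
  - exact: integrable_EFinZl.
have tiltE e s : pi s * expR (- (n%:R * cont_risk x rho e x0 s)) = tilt pi U V e s.
  by rewrite /tilt /U /V /cont_risk; congr (_ * expR _); rewrite /nn; ring.
have MnormE e : Mnorm D pi n (cont_risk x rho e x0) =
    (\int[lebesgue_measure]_(s in D) (tilt pi U V e s)%:E)%E.
  by apply: eq_integral => s _; rewrite tiltE.
have tilt0 : tilt pi U V 0 = g.
  by apply/funext => s; rewrite /tilt /g subr0 mul1r mul0r addr0.
split.
  move=> e e01; rewrite /cont_post_defined MnormE; apply/andP; split.
    (* The weights at [e] and at [0] vanish exactly where [pi] does, so positivity is inherited from
       the uncontaminated posterior. *)
    apply: (@integral_gt0_supp _ _ g) => //.
    - exact: measurable_tilt.
    - by move=> s Ds; rewrite mulr_ge0 ?expR_ge0 ?p0.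
    - move=> s Ds /eqP; rewrite mulf_eq0 [X in _ || X]gt_eqF ?expR_gt0// orbF => /eqP p00.
      by rewrite /g p00 mul0r.
    - by have /andP[] := defd.
  have ie : (@lebesgue_measure R).-integrable D (EFin \o tilt pi U V e).
    exact: integrable_tilt.
  by have /integrable_fin_num := ie => /(_ mD); rewrite fin_numElt => /andP[].
pose l := (g t * W t * Z - g t * Rintegral lebesgue_measure D (fun s => g s * W s)) / Z ^+ 2.
exists l; split.
  rewrite /is_PIF /Mpost.
  under eq_fun do rewrite !MnormE !tiltE.
  have := @cvg_diff_quotient R (fun e => tilt pi U V e t)
    (fun e => Rintegral lebesgue_measure D (tilt pi U V e)) (g t * W t)
    (Rintegral lebesgue_measure D (fun s => g s * W s)).
  rewrite tilt0; apply; first by rewrite gt_eqF.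
    rewrite /g -mulrA.
    rewrite (_ : (fun e : R => _) = (fun e => pi t *
      (e^-1 * (expR ((1 - e) * U t + e * V t) - expR (U t))))); last first.
      by apply/funext => e; rewrite /tilt; ring.
    by apply: cvgMl_tmp; exact: cvg_expR_chord.
  move: (@cvg_Rintegral_tilt R D pi U V mD p0 mp mU mV ig iV igW).
  by rewrite tilt0; apply.
rewrite /l normrM normfV (ger0_norm (exprn_ge0 _ (ltW Z0))).
rewrite ler_pM2r ?invr_gt0 ?exprn_gt0//.
have -> : g t * W t * Z - g t * Rintegral lebesgue_measure D (fun s => g s * W s) =
  g t * (W t * Z - Rintegral lebesgue_measure D (fun s => g s * W s)) by ring.
rewrite normrM (ger0_norm (g0 _ Dt)).
have K0 : 0 <= 2 * (nn * M) by rewrite !mulr_ge0// ltW.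
have dev := @weighted_deviation_le R D g W (2 * (nn * M)) t mD mg mW g0 K0
  (fun s Ds => lipW _ _ Dt Ds) ig igW iU.
apply: (le_trans (ler_wpM2l (g0 _ Dt) dev)).
have I10 : 0 <= I1.
  by apply: Rintegral_ge0 => s Ds; rewrite mulr_ge0 ?g0// addr_ge0.
(* Regrouped so that [1 + |t|] meets [g t] and the bound [A] applies. *)
rewrite [leLHS](_ : _ = 2 * (nn * M) * ((1 + `|t|) * g t) * I1); last first.
  by rewrite /I1; ring.
rewrite ler_wpM2r// ler_wpM2l//.
exact: UA.
Qed.
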